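(* Let $1<p<\infty$ and $q=p/(p-1)$. Let $f:\mathbb R\to\mathbb R$ be a measurable function such that: (1) $f\in L_1(\mathbb R)$; (2) $(f(\cdot-n))_{n\in\mathbb Z}$ is an orthonormal sequence in $L_2(\mathbb R)$; (3) $\sup_{t\in\mathbb R}\sum_{n\in\mathbb Z}|f(t-n)|<\infty$. For $t\in\mathbb R$ let $x_t=(f(t-n))_{n\in\mathbb Z}\in\ell_p(\mathbb Z)$ and $f_t=(f(t-n))_{n\in\mathbb Z}\in\ell_q(\mathbb Z)$. Then $\psi:\mathbb R\to\ell_p(\mathbb Z)\times\ell_q(\mathbb Z)$ given by $\psi(t)=(x_t,f_t)$ is a continuous Schauder frame of $\ell_p(\mathbb Z)$ (over $\mathbb R$ with Lebesgue measure). Furthermore, $\psi$ has suppression unconditionality constant $C_s=\|f\|_1\sup_{t\in\mathbb R}\sum_{n\in\mathbb Z}|f(t-n)|$.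
   Context: Pettis integral: for a $\sigma$-finite measure space $(M,\Sigma,\mu)$ and a separable Banach space $X$, a function $F:M\to X$ is Pettis integrable if for every $E\in\Sigma$ there is $x_E\in X$ with $g(x_E)=\int_E g(F)\,d\mu$ (Lebesgue integral) for all $g\in X^*$; then $\int_E F\,d\mu:=x_E$. Continuous Schauder frame: a measurable map $t\mapsto (x_t,f_t)\in X\times X^*$ on $M$, where $X$ is a separable Banach space, is a continuous Schauder frame of $X$ if for every $x\in X$ the function $t\mapsto f_t(x)x_t$ is Pettis integrable and $x=\int_M f_t(x)x_t\,d\mu(t)$. Suppression unconditionality constant: for a continuous Schauder frame $(x_t,f_t)_{t\in M}$ of $X$, this is the least constant $B_s$ such that $\left|\int_E f_t(x)\,g(x_t)\,d\mu(t)\right|\le B_s\|x\|\|g\|$ for every measurable $E\subseteq M$, every $x\in X$ and every $g\in X^*$. Here $\ell_q(\mathbb Z)$ is identified with $\ell_p(\mathbb Z)^*$ by letting $(b_n)_{n\in\mathbb Z}$ act on $(a_n)_{n\in\mathbb Z}$ as $\sum_{n\in\mathbb Z}a_nb_n$.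
   Formalization: The least suppression constant is shown to exist and be at most C_s, not equal to it; equality fails e.g. for f=a on [0,1/2), b on [1/2,1), 0 elsewhere, a>b>0, a²+b²=2, where the least constant is 1 but C_s=a(a+b)/2>1. *)

(* Defs.v *)
From HB Require Import structures.
From mathcomp Require Import all_boot all_order all_algebra finmap.
From mathcomp Require Import all_classical all_reals all_analysis.

Set Implicit Arguments.
Unset Strict Implicit.
Unset Printing Implicit Defensive.

Import Order.TTheory GRing.Theory Num.Theory.
Import numFieldNormedType.Exports.

Local Open Scope classical_set_scope.
Local Open Scope ring_scope.

Section topological_dual.
Context {R : realType} (X : normedModType R).

Definition continuous_functional : {pred X -> R^o} :=
  [pred f : X -> R^o | `[< linear f /\ continuous f >]].

Record topdual := TopDual {
  topdual_fun :> X -> R^o ;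
  topdualP : topdual_fun \in continuous_functional }.

HB.instance Definition _ := [isSub for topdual_fun].
HB.instance Definition _ := [Choice of topdual by <:].

Lemma topdual_linear (f : topdual) : linear f.
Proof. by case: f => f /= /asboolP[]. Qed.

Lemma topdual_continuous (f : topdual) : continuous f.
Proof. by case: f => f /= /asboolP[]. Qed.

HB.instance Definition _ (f : topdual) :=
  GRing.isLinear.Build R X R^o *:%R f (topdual_linear f).

Lemma continuous_functional_submod : submod_closed continuous_functional.
Proof.
split=> [|a f g /asboolP[lf cf] /asboolP[lg cg]]; apply/asboolP; split.
- by move=> a x y /=; rewrite scaler0 addr0.
- by move=> x; exact: cvg_cst.
- move=> b x y; rewrite !fctE lf lg !scalerDr !scalerA (mulrC a b).
  by rewrite addrACA.
- by move=> x; apply: cvgD; [apply: cvgZr; exact: cf|exact: cg].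
Qed.

HB.instance Definition _ := GRing.isSubmodClosed.Build R (X -> R^o)
  continuous_functional continuous_functional_submod.

HB.instance Definition _ := [SubChoice_isSubLmodule of topdual by <:].

Lemma topdual_addE (f g : topdual) x : (f + g) x = f x + g x.
Proof. by []. Qed.

Lemma topdual_scaleE (a : R) (f : topdual) x : (a *: f) x = a * f x.
Proof. by []. Qed.

(* The operator norm. *)
Definition topdual_norm (f : topdual) : R :=
  sup [set `|f x| | x in [set x : X | `|x| <= 1]].

Lemma topdual_norm_has_sup (f : topdual) :
  has_sup [set `|f x| | x in [set x : X | `|x| <= 1]].
Proof.
split; first by exists `|f 0|, 0; rewrite //= normr0.
have /linear_boundedP : bounded_near f (nbhs (0 : X)).
  by apply: continuous_linear_bounded; exact: topdual_continuous.
move=> /pinfty_ex_gt0[r r0 fr]; exists r => _ [x /= x1 <-].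
by rewrite (le_trans (fr x))// ler_piMr// ltW.
Qed.

Lemma topdual_norm_ge0 (f : topdual) : 0 <= topdual_norm f.
Proof.
apply: (le_trans (normr_ge0 (f 0))); apply: ub_le_sup.
  by have [] := topdual_norm_has_sup f.
by exists 0; rewrite //= normr0.
Qed.

Lemma topdual_le_norm (f : topdual) x : `|f x| <= topdual_norm f * `|x|.
Proof.
have [->|x0] := eqVneq x 0; first by rewrite linear0 !normr0 mulr0.
have nx0 : 0 < `|x| by rewrite normr_gt0.
rewrite -ler_pdivrMr// -[leLHS]mulr1.
have -> : `|f x| / `|x| * 1 = `|f (`|x|^-1 *: x)|.
  by rewrite linearZ/= normrM ger0_norm ?invr_ge0// mulr1 mulrC.
apply: ub_le_sup; first by have [] := topdual_norm_has_sup f.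
by exists (`|x|^-1 *: x); rewrite //= normfZV.
Qed.

Lemma topdual_norm_le (f : topdual) (r : R) : 0 <= r ->
  (forall x, `|f x| <= r * `|x|) -> topdual_norm f <= r.
Proof.
move=> r0 fr; apply: ge_sup; first by have [] := topdual_norm_has_sup f.
by move=> _ [x /= x1 <-]; rewrite (le_trans (fr x))// ler_piMr.
Qed.

Lemma topdual_normD (f g : topdual) :
  topdual_norm (f + g) <= topdual_norm f + topdual_norm g.
Proof.
apply: topdual_norm_le => [|x]; first by rewrite addr_ge0// topdual_norm_ge0.
by rewrite topdual_addE (le_trans (ler_normD _ _))// mulrDl lerD//
  topdual_le_norm.
Qed.

Lemma topdual_normZ (a : R) (f : topdual) :
  topdual_norm (a *: f) = `|a| * topdual_norm f.
Proof.
have le_normZ b g : topdual_norm (b *: g) <= `|b| * topdual_norm g.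
  apply: topdual_norm_le => [|x]; first by rewrite mulr_ge0// topdual_norm_ge0.
  by rewrite topdual_scaleE normrM -mulrA ler_wpM2l// topdual_le_norm.
apply/eqP; rewrite eq_le le_normZ/=.
have [->|a0] := eqVneq a 0; first by rewrite normr0 mul0r topdual_norm_ge0.
rewrite -ler_pdivlMl ?normr_gt0// -normfV.
by rewrite (le_trans _ (le_normZ _ _))// scalerA mulVf// scale1r.
Qed.

Lemma topdual_norm_eq0 (f : topdual) : topdual_norm f = 0 -> f = 0.
Proof.
move=> f0; apply/val_inj/funext => x /=.
by apply/normr0_eq0/le_anti; rewrite normr_ge0 andbT;
  rewrite (le_trans (topdual_le_norm f x))// f0 mul0r.
Qed.

HB.instance Definition _ := Lmodule_isNormed.Build R topdual
  topdual_normD topdual_normZ topdual_norm_eq0.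

End topological_dual.

(* int carries the discrete sigma-algebra, so that every sequence is measurable
   and the integral against [counting] is the sum over Z. *)
HB.instance Definition _ := isPointed.Build int 0.

HB.instance Definition _ := @isMeasurable.Build default_measure_display
  int discrete_measurable discrete_measurable0
  discrete_measurableC discrete_measurableU.

(* l_p(Z) is L_p of the counting measure on Z.  No quotient is needed: counting
   has no nonempty null set, so the L_p norm separates the elements. *)
Definition ellZ {R : realType} (p : R) (p1 : 1 <= p) :=
  LfunType (@counting int R) (p1 : (1 <= p%:E)%E).

HB.instance Definition _ (R : realType) (p : R) (p1 : 1 <= p) :=
  GRing.Lmodule.on (ellZ p1).

Section ellZ_norm.
Context {R : realType} (p : R) (p1 : 1 <= p).

Definition ellZ_fun (a : ellZ p1) : int -> R := a.
Coercion ellZ_fun : ellZ >-> Funclass.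

Lemma ellZP (a b : ellZ p1) : a =1 b -> a = b.
Proof. by move=> ab; apply/LfuneqP. Qed.

Lemma ellZ_addE (a b : ellZ p1) n : (a + b) n = a n + b n.
Proof. by []. Qed.

Lemma ellZ_oppE (a : ellZ p1) n : (- a) n = - a n.
Proof. by []. Qed.

Lemma ellZ_scaleE (r : R) (a : ellZ p1) n : (r *: a) n = r * a n.
Proof. by []. Qed.

Definition ellZ_norm (a : ellZ p1) : R :=
  fine ('N[@counting int R]_(p%:E)[EFin \o a]).

Lemma ellZ_normE (a : ellZ p1) :
  (ellZ_norm a)%:E = ('N[@counting int R]_(p%:E)[EFin \o a])%E.
Proof. exact: finite_norm_fine. Qed.

Lemma measurable_fun_int d (T : measurableType d) (u : int -> T) :
  measurable_fun [set: int] u.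
Proof. by []. Qed.

Lemma ellZ_norm_ge0 (a : ellZ p1) : 0 <= ellZ_norm a.
Proof. by rewrite fine_ge0// Lnorm_ge0. Qed.

Lemma ellZ_coord_le (a : ellZ p1) n : `|a n| <= ellZ_norm a.
Proof.
have p0 : 0 < p by rewrite (lt_le_trans ltr01).
rewrite -lee_fin ellZ_normE.
have -> : (`|a n|%:E = (`|a n|%:E `^ p) `^ p^-1)%E.
  by rewrite !poweR_EFin -powRrM mulfV ?gt_eqF// powRr1.
have itv0y (y : \bar R) : (0 <= y)%E -> y \in `[0%E, +oo%E].
  by move=> y0; rewrite in_itv/= y0 leey.
have n0 : (0 <= \int[@counting int R]_x (`|(a x)%:E| `^ p))%E.
  by apply: integral_ge0 => x _; exact: poweR_ge0.
rewrite unlock /Lnorm gt0_ler_poweR ?invr_ge0 ?(ltW p0) ?itv0y ?poweR_ge0//.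
apply: (@le_trans _ _ (\int[@counting int R]_(x in [set n]) (`|(a x)%:E| `^ p))%E).
  rewrite (@eq_integral _ _ _ _ [set n] (cst (`|a n|%:E `^ p)%E)); last first.
    by move=> x /[!inE] ->.
  rewrite integral_cst//= /counting asboolT// fset_set1 cardfs1 mule1.
  by [].
apply: ge0_subset_integral => //= x _; exact: poweR_ge0.
Qed.

Lemma ellZ_normD (a b : ellZ p1) : ellZ_norm (a + b) <= ellZ_norm a + ellZ_norm b.
Proof. exact: ler_LnormD. Qed.

Lemma ellZ_normZ (r : R) (a : ellZ p1) : ellZ_norm (r *: a) = `|r| * ellZ_norm a.
Proof.
apply/EFin_inj; rewrite EFinM !ellZ_normE.
exact: (@LnormZ _ _ _ _ _ (p1 : (1 <= p%:E)%E) a r).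
Qed.

Lemma ellZ_norm_eq0 (a : ellZ p1) : ellZ_norm a = 0 -> a = 0.
Proof.
move=> a0; apply: ellZP => n; apply/normr0_eq0/le_anti.
by rewrite normr_ge0 andbT (le_trans (ellZ_coord_le a n))// a0.
Qed.

HB.instance Definition _ := Lmodule_isNormed.Build R (ellZ p1)
  ellZ_normD ellZ_normZ ellZ_norm_eq0.

Lemma ellZ_norm_normE (a : ellZ p1) : `|a| = ellZ_norm a.
Proof. by []. Qed.

End ellZ_norm.
Section ellZ_complete.
Context {R : realType} (p : R) (p1 : 1 <= p).

Let p0 : 0 < p. Proof. by rewrite (lt_le_trans ltr01). Qed.

Lemma ellZ_norm_powR (a : ellZ p1) :
  ((`|a| `^ p)%:E = \int[@counting int R]_n (`|a n| `^ p)%:E)%E.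
Proof.
rewrite -poweR_EFin ellZ_norm_normE ellZ_normE.
by rewrite powR_Lnorm ?gt_eqF//.
Qed.

Lemma powR_le_limn_einf (u : R^nat) (l : R) : u @ \oo --> l ->
  ((`|l| `^ p)%:E <= limn_einf (fun k => (`|u k| `^ p)%:E))%E.
Proof.
move=> ul; have [->|l0] := eqVneq l 0.
  rewrite normr0 powR0 ?gt_eqF// limn_einf_lim.
  apply: lime_ge; first exact: is_cvg_einfs.
  by apply: nearW => n; apply: le_ereal_inf_tmp => _ [k /= _ <-];
    rewrite lee_fin powR_ge0.
have cp : {for `|l|, continuous (@powR R ^~ p)}.
  apply/differentiable_continuous/derivable1_diffP.
  by apply: derivable_powR; rewrite in_itv/= normr_gt0 l0.
have /cvg_limn_einf_sup[-> _] // :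
  (`|u k| `^ p)%:E @[k --> \oo] --> (`|l| `^ p)%:E.
apply: cvg_EFin; first exact: nearW.
by apply: (continuous_cvg _ cp); exact: cvg_norm.
Qed.

Lemma ellZ_fatou (u : nat -> ellZ p1) (l : int -> R) (C : R) :
  (forall n, u k n @[k --> \oo] --> l n) -> (forall k, `|u k| <= C) ->
  exists b : ellZ p1, (forall n, b n = l n) /\ `|b| <= C.
Proof.
move=> ul uC; have C0 : 0 <= C by rewrite (le_trans _ (uC 0%N)).
have intl : (\int[@counting int R]_n (`|l n| `^ p)%:E <= (C `^ p)%:E)%E.
  apply: (@le_trans _ _ (\int[@counting int R]_n
      limn_einf (fun k => (`|u k n| `^ p)%:E))%E).
    apply: ge0_le_integral => //.
    by move=> n _; apply: powR_le_limn_einf; exact: ul.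
  apply: (le_trans (@fatou _ _ _ (@counting int R) setT measurableT
    (fun k n => (`|u k n| `^ p)%:E) _ _)) => //.
  rewrite limn_einf_lim; apply: lime_le; first exact: is_cvg_einfs.
  apply: nearW => k; apply: (@le_trans _ _
    (\int[@counting int R]_n (`|u k n| `^ p)%:E)%E).
    by apply: ereal_inf_lbound; exists k => //=.
  rewrite -ellZ_norm_powR lee_fin ge0_ler_powR ?nnegrE//; exact: ltW.
have nl : ('N[@counting int R]_(p%:E)[EFin \o l] `^ p <= (C `^ p)%:E)%E.
  by rewrite powR_Lnorm ?gt_eqF.
have lLfun : (l : int -> R) \in Lfun (@counting int R) p%:E.
  rewrite inE; apply/andP; split; first by rewrite inE.
  rewrite inE/= /finite_norm; apply: (@lty_poweRy _ _ p); rewrite ?gt_eqF//.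
  by rewrite (le_lt_trans nl)// ltry.
pose b : ellZ p1 := Lfun_Sub (p1 : (1 <= p%:E)%E) lLfun.
exists b; split=> //.
have := intl; rewrite -(ellZ_norm_powR b) lee_fin.
apply: contraTT; rewrite -!ltNge => Cb.
by rewrite gt0_ltr_powR// nnegrE// (le_trans C0)// ltW.
Qed.

Lemma ellZ_complete (F : set_system (ellZ p1)) :
  ProperFilter F -> cauchy F -> cvg F.
Proof.
move=> PF /cauchyP Fc.
have e0 k : 0 < k.+1%:R^-1 :> R by rewrite invr_gt0.
pose c k : ellZ p1 := projT1 (cid (Fc _ (e0 k))).
have Fck k : F (ball (c k) k.+1%:R^-1) := projT2 (cid (Fc _ (e0 k))).
have dc j k : `|c j - c k| <= j.+1%:R^-1 + k.+1%:R^-1.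
  have [z [jz kz]] := filter_ex (filterI (Fck j) (Fck k)).
  move: jz kz; rewrite -!ball_normE/= => jz kz.
  have -> : c j - c k = (c j - z) - (c k - z) by rewrite opprB addrA subrK.
  by rewrite (le_trans (ler_normB _ _))// lerD// ltW.
have cc n : cvg (c k n @[k --> \oo]).
  apply: cauchy_cvg; apply: cauchy_exP => e ep.
  near \oo => j; exists (c j n).
  suff : \forall k \near \oo, ball (c j n) e (c k n) by [].
  near=> k; rewrite -ball_normE/=.
  apply: le_lt_trans (ellZ_coord_le (c j - c k) n) _.
  rewrite (le_lt_trans (dc _ _))// (splitr e) ltrD//.
    by near: j; exact: near_infty_natSinv_lt (PosNum (divr_gt0 ep (ltr0Sn _ 1))).
  by near: k; exact: near_infty_natSinv_lt (PosNum (divr_gt0 ep (ltr0Sn _ 1))).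
pose l n := lim (c k n @[k --> \oo]).
have cl j : exists b : ellZ p1, (forall n, b n = c j n - l n) /\
    `|b| <= 2 * j.+1%:R^-1.
  apply: (@ellZ_fatou (fun k => c j - c (k + j)%N)).
    move=> n.
    apply: (@cvgB _ R^o _ _ _ (cst (c j n)) (fun k => c (k + j)%N n));
      first exact: cvg_cst.
    by rewrite (cvg_shiftn j (fun k => c k n)); exact: cc.
  move=> k; rewrite (le_trans (dc _ _))// mulr_natl mulr2n lerD2l.
  by rewrite lef_pV2 ?posrE// ler_nat ltnS leq_addl.
have [b0 [b0E _]] := cl 0%N.
pose L : ellZ p1 := c 0%N - b0.
have LE n : L n = l n by rewrite [LHS]/(c 0%N n - b0 n) b0E; exact: subKr.
apply/cvg_ex; exists L; apply/cvgrPdist_lt => e ep.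
near \oo => j; have [b [bE bj]] := cl j.
have {}bE : b = c j - L.
  by apply: ellZP => n; rewrite bE [RHS]/(c j n - L n) LE.
apply: filterS (Fck j) => z; rewrite -ball_normE/= => cz.
have -> : L - z = (c j - z) - (c j - L).
  by rewrite opprB [RHS]addrC addrA subrK.
rewrite (le_lt_trans (ler_normB _ _))// -bE.
rewrite (lt_le_trans (ltr_leD cz bj))//.
rewrite -[X in X + _]mul1r -mulrDl -ler_pdivlMl// ltW//.
by near: j; apply: (near_infty_natSinv_lt (PosNum _)); rewrite mulr_gt0 ?invr_gt0.
Unshelve. all: by end_near. Qed.

HB.instance Definition _ := Uniform_isComplete.Build (ellZ p1) ellZ_complete.

End ellZ_complete.

Section conjugate_exponent.
Context {R : realType} (p q : R) (hp : 1 < p) (hq : q = p / (p - 1)).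

Lemma conjugate_ge1 : 1 <= q.
Proof. by rewrite hq ler_pdivlMr ?subr_gt0// mul1r gerBl. Qed.

Lemma conjugate_sum : p^-1 + q^-1 = 1.
Proof.
have p0 : p != 0 by rewrite gt_eqF// (lt_trans ltr01).
by rewrite hq invf_div -[X in X + _]mul1r -mulrDl subrKC divff.
Qed.

End conjugate_exponent.

Section ellZ_pairing.
Context {R : realType} (p q : R) (p1 : 1 <= p) (q1 : 1 <= q).
Hypothesis pq : p^-1 + q^-1 = 1.

(* The action of (b_n) in l_q(Z) on (a_n) in l_p(Z) by \sum_n a_n b_n. *)
Definition ellZ_pairing (b : ellZ q1) (a : ellZ p1) : R^o :=
  \int[@counting int R]_n (a n * b n).

Lemma ellZ_pairing_abs (b : ellZ q1) (a : ellZ p1) :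
  (\int[@counting int R]_n `|(a n * b n)%:E| <= (`|b| * `|a|)%:E)%E.
Proof.
have := @hoelder _ _ _ (@counting int R) a b p q (measurable_fun_int a)
  (measurable_fun_int b) (lt_le_trans ltr01 p1) (lt_le_trans ltr01 q1) pq.
by rewrite Lnorm1 -!ellZ_normE -EFinM mulrC.
Qed.

Lemma ellZ_pairing_integrable (b : ellZ q1) (a : ellZ p1) :
  (@counting int R).-integrable [set: int] (fun n => (a n * b n)%:E).
Proof.
apply/integrableP; split=> //.
by rewrite (le_lt_trans (ellZ_pairing_abs b a))// ltry.
Qed.

Lemma ellZ_pairing_le (b : ellZ q1) (a : ellZ p1) :
  `|ellZ_pairing b a| <= `|b| * `|a|.
Proof.
rewrite -lee_fin (le_trans _ (ellZ_pairing_abs b a))//.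
rewrite /ellZ_pairing /Rintegral -abse_EFin fineK; last first.
  exact: integrable_fin_num (ellZ_pairing_integrable b a).
exact: le_abse_integral.
Qed.

Lemma ellZ_pairing_linear (b : ellZ q1) : linear (ellZ_pairing b).
Proof.
move=> r a a'; rewrite /ellZ_pairing.
have -> : (fun n => (r *: a + a') n * b n) =
    (fun n => r * (a n * b n) + a' n * b n).
  by apply/funext => n; rewrite -[(r *: a + a') n]/(r * a n + a' n) mulrDl mulrA.
rewrite RintegralD//; last 2 first.
- exact: (integrableZl measurableT _ (ellZ_pairing_integrable b a)).
- exact: ellZ_pairing_integrable.
by rewrite RintegralZl//; exact: ellZ_pairing_integrable.
Qed.

Lemma ellZ_pairing_continuous (b : ellZ q1) : continuous (ellZ_pairing b).
Proof.
pose f : {linear ellZ p1 -> R^o} := HB.pack (ellZ_pairing b)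
  (GRing.isLinear.Build _ _ _ _ _ (ellZ_pairing_linear b)).
apply: (@bounded_linear_continuous _ _ _ f); apply/linear_boundedP.
near=> r => a; rewrite (le_trans (ellZ_pairing_le b a))// ler_wpM2r//.
Unshelve. all: by end_near. Qed.

Definition ellZ_dual (b : ellZ q1) : topdual (ellZ p1) :=
  TopDual (asboolT (conj (ellZ_pairing_linear b) (@ellZ_pairing_continuous b))).

End ellZ_pairing.

Section continuous_frames.
Context {d} {M : measurableType d} {R : realType}.
Variable mu : {sigma_finite_measure set M -> \bar R}.
Context {X : completeNormedModType R}.

Definition separable_space (T : topologicalType) :=
  exists2 A : set T, countable A & dense A.

(* Applied below with T = X * topdual X, topdual X having its norm topology. *)
Definition borel_measurable (T : topologicalType) (F : M -> T) :=
  forall U : set T, open U -> measurable (F @^-1` U).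

Definition is_pettis_integral (E : set M) (F : M -> X) (x : X) :=
  forall g : topdual X,
    mu.-integrable E (fun t => (g (F t))%:E) /\
    g x = \int[mu]_(t in E) g (F t).

Definition pettis_integrable (F : M -> X) :=
  forall E, measurable E -> exists x, is_pettis_integral E F x.

Definition continuous_schauder_frame (psi : M -> X * topdual X) :=
  [/\ separable_space X,
      borel_measurable psi &
      forall x, pettis_integrable (fun t => (psi t).2 x *: (psi t).1) /\
        is_pettis_integral [set: M] (fun t => (psi t).2 x *: (psi t).1) x].

(* psi t = (x_t, f_t), so the integrand is f_t(x) g(x_t). *)
Definition suppression_bound (psi : M -> X * topdual X) (B : R) :=
  forall E, measurable E -> forall (x : X) (g : topdual X),
    `|\int[mu]_(t in E) ((psi t).2 x * g (psi t).1)| <= B * `|x| * `|g|.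

Definition is_suppression_constant (psi : M -> X * topdual X) (B : R) :=
  suppression_bound psi B /\
  forall B', suppression_bound psi B' -> B <= B'.

Definition orthonormal_L2 (I : eqType) (u : I -> M -> R) :=
  (forall i, u i \in Lfun mu 2%:E) /\
  (forall i j, \int[mu]_t (u i t * u j t) = (i == j)%:R).

End continuous_frames.

(* \sup_t \sum_(n in Z) |f(t - n)|, over all t: not an essential supremum. *)
Definition translation_sup {R : realType} (f : R -> R) : \bar R :=
  ereal_sup (range (fun t => \esum_(n in [set: int]) `|f (t - n%:~R)|%:E)).

(* Main.v *)
(** By Riesz duality a functional [g] on [l_p] is given by some [b] in [l_q].
    Let [a_n] be the coordinates of [x].  Expanding both sums and substituting
    [m = n + k], Tonelli's theorem and translation invariance give
      [\int |f_t(x) g(x_t)| dt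
        <= \sum_k (\int |f(s) f(s - k)| ds) (\sum_n |a_n b_(n+k)|)],
    where Hoelder bounds the inner sum by [|x| |g|] and what remains is
    [\int |f(s)| \sum_k |f(s - k)| ds <= |f|_1 sup_t \sum_n |f(t - n)|].
    This is the suppression bound.  It also makes
    [b |-> \int_E f_t(x) b(x_t) dt] a bounded functional on [l_q], and the
    Pettis integral over [E] is the element of [l_p] that represents it.  For
    [E] the whole line its [n]-th coordinate is a continuous functional of [x]
    that agrees with [a_n] on the unit vectors by orthonormality, hence
    everywhere. *)
From HB Require Import structures.
Require Import Defs.
From mathcomp Require Import all_boot all_order all_algebra finmap.
From mathcomp Require Import all_classical all_reals all_analysis.
From mathcomp Require Import measurable_realfun.

Set Implicit Arguments.
Unset Strict Implicit.
Unset Printing Implicit Defensive.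

Import Order.TTheory GRing.Theory Num.Theory.
Import numFieldNormedType.Exports.

Local Open Scope classical_set_scope.
Local Open Scope ring_scope.

(** * Sums over the integers as integrals against counting measure *)

Definition int_of_nat (k : nat) : int :=
  if odd k then Negz k./2 else Posz k./2.

(** Since [Negz m] is -(m + 1), the integers are listed as 0, -1, 1, -2, ...; this is the position
    of [n] in the list, and the truncations below cut at that position. *)
Definition nat_of_int (n : int) : nat :=
  match n with Posz m => m.*2 | Negz m => m.*2.+1 end.

Lemma int_of_natK : cancel int_of_nat nat_of_int.
Proof.
move=> k; rewrite /int_of_nat -[RHS](odd_double_half k).
by case: (odd k).
Qed.

Lemma nat_of_intK : cancel nat_of_int int_of_nat.
Proof.
by case=> m; rewrite /int_of_nat /= odd_double /= ?doubleK ?uphalf_double.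
Qed.

Lemma can_set_bij (T U : Type) (f : T -> U) (g : U -> T) :
  cancel f g -> cancel g f -> set_bij [set: T] [set: U] f.
Proof.
move=> fK gK; split=> // [x y _ _|y _]; first exact: (can_inj fK).
by exists (g y).
Qed.

Section counting_int.
Local Open Scope ereal_scope.
Context {R : realType}.
Implicit Types c : int -> \bar R.

(** Dirac masses at points outside [A] contribute nothing, so both sides count [A]. In this form the
    integral against a series of measures becomes a series. *)
Lemma counting_int_dirac (A : set int) :
  counting A = \sum_(k <oo) \d_(int_of_nat k) A :> \bar R.
Proof.
have -> : \sum_(k <oo) \d_(int_of_nat k) A = \esum_(i in A) \d_ i A :> \bar R.
  rewrite nneseries_esumT//.
  rewrite -(@reindex_esum _ _ _ setT setT int_of_nat (fun i => \d_i A));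
    last exact: can_set_bij int_of_natK nat_of_intK.
  rewrite [in LHS](esumID A)// !setTI [X in _ + X](_ : _ = 0) ?adde0//.
  by apply: esum1 => i Ai; rewrite /= /dirac indicE memNset.
rewrite /counting/=; case: ifPn => /asboolP finA.
  by rewrite -finite_card_dirac.
by rewrite infinite_card_dirac.
Qed.

Lemma integral_counting_int c : (forall n, 0 <= c n) ->
  \int[counting]_n c n = \sum_(k <oo) c (int_of_nat k).
Proof.
move=> c0.
transitivity (\int[mseries (fun k => \d_(int_of_nat k)) O]_t c t).
  congr (integral _ _ _); apply/funext => A.
  by rewrite /= counting_int_dirac.
rewrite (@ge0_integral_measure_series _ _ R
  (fun k => \d_(int_of_nat k)) setT)//=.
by apply: eq_eseriesr=> i _; rewrite integral_dirac//= diracT mul1e.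
Qed.

Lemma integral_counting_esum c : (forall n, 0 <= c n) ->
  \int[counting]_n c n = \esum_(n in [set: int]) c n.
Proof.
move=> c0; rewrite integral_counting_int// nneseries_esumT//.
by apply/esym/reindex_esum; exact: can_set_bij int_of_natK nat_of_intK.
Qed.

Lemma integral_counting_shift c (m : int) : (forall n, 0 <= c n) ->
  \int[counting]_n c n = \int[counting]_n c (m + n)%R.
Proof.
move=> c0; rewrite !integral_counting_esum//.
by apply: reindex_esum; apply: can_set_bij (addKr m) (addNKr m).
Qed.

Section tonelli.
Context d (T : measurableType d) (mu : {measure set T -> \bar R}).
Context (F : int -> T -> \bar R).
Hypotheses (F0 : forall n t, 0 <= F n t)
  (mF : forall n, measurable_fun [set: T] (F n)).

Lemma measurable_integral_counting :
  measurable_fun [set: T] (fun t => \int[counting]_n F n t).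
Proof.
under eq_fun do rewrite integral_counting_int//.
exact: ge0_emeasurable_sum.
Qed.

(** Along the enumeration the inner integral is a series of nonnegative functions, which may be
    integrated term by term. *)
Lemma tonelli_counting :
  \int[mu]_t (\int[counting]_n F n t) = \int[counting]_n (\int[mu]_t F n t).
Proof.
rewrite integral_counting_int; last by move=> n; exact: integral_ge0.
under eq_integral do rewrite integral_counting_int//.
by rewrite integral_nneseries.
Qed.

End tonelli.
End counting_int.

(** * Translation invariance of Lebesgue measure *)

Section lebesgue_translation.
Local Open Scope ereal_scope.
Context {R : realType}.
Local Notation mu := (@lebesgue_measure R).


Definition translate (c : R) : measurableTypeR R -> measurableTypeR R :=
  fun t => (t - c)%R.

Lemma measurable_translate (c : R) :
  measurable_fun [set: measurableTypeR R] (translate c).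
Proof. exact: measurable_funB. Qed.

HB.instance Definition _ (c : R) :=
  isMeasurableFun.Build _ _ _ _ (translate c) (measurable_translate c).

(** Lebesgue measure is determined by its values on half-open intervals, and the preimage of such an
    interval is its translate by [c], of the same length. *)
Lemma lebesgue_measure_translate (c : R) (A : set (measurableTypeR R)) :
  measurable A -> pushforward mu (translate c) A = mu A.
Proof.
move=> mA; apply/esym.
apply: (lebesgue_measure_unique (mu := pushforward mu (translate c))) => //.
move=> _ [[a b]] _ <-; rewrite /pushforward.
transitivity (mu `](a + c)%R, (b + c)%R]%classic); last first.
  congr (mu _); apply/seteqP.
  by split=> t /=; rewrite !in_itv/= ltrBrDr lerBlDr.
rewrite !lebesgue_measure_itv/= !lte_fin ltrD2r -!EFinB.
by rewrite opprD addrACA subrr addr0.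
Qed.

Lemma integral_translate (c : R) (g : measurableTypeR R -> \bar R) :
  measurable_fun [set: measurableTypeR R] g -> (forall t, 0 <= g t) ->
  \int[mu]_t g (t - c)%R = \int[mu]_t g t.
Proof.
move=> mg g0; transitivity (\int[pushforward mu (translate c)]_t g t).
  by rewrite ge0_integral_pushforward//; exact: measurable_translate.
by apply: eq_measure_integral => A mA _; exact: lebesgue_measure_translate.
Qed.

End lebesgue_translation.

(** * Finitely supported sequences: density, unit vectors, separability *)

Section ellZ_truncation.
Context {R : realType} (p : R) (p1 : 1 <= p).
Implicit Types (c : int -> R) (a b : ellZ p1).

Let p0 : 0 < p. Proof. by rewrite (lt_le_trans ltr01). Qed.

Lemma ellZ_funB a b n : ellZ_fun (a - b) n = ellZ_fun a n - ellZ_fun b n.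
Proof. by []. Qed.

Lemma ellZ_funZ (r : R) a n : ellZ_fun (r *: a) n = r * ellZ_fun a n.
Proof. by []. Qed.

Lemma ellZ_exists c : (\int[@counting int R]_n (`|c n| `^ p)%:E < +oo)%E ->
  exists a : ellZ p1, forall n, a n = c n.
Proof.
move=> intc.
have cLfun : c \in Lfun (@counting int R) p%:E.
  rewrite inE; apply/andP; split; first by rewrite inE.
  rewrite inE/= /finite_norm; apply: (@lty_poweRy _ _ p); rewrite ?gt_eqF//.
  by rewrite powR_Lnorm ?gt_eqF.
by exists (Lfun_Sub (p1 : (1 <= p%:E)%E) cLfun).
Qed.

Definition trunc_seq N c n := if (nat_of_int n < N)%N then c n else 0.

Lemma integral_trunc_seq N c (h : R -> R) : h 0 = 0 -> (forall x, 0 <= h x) ->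
  (\int[@counting int R]_n (h (trunc_seq N c n))%:E =
   (\sum_(k < N) h (c (int_of_nat k)))%:E)%E.
Proof.
move=> h0 h_ge0; rewrite integral_counting_int;
  last by move=> n; rewrite lee_fin.
rewrite (nneseries_split 0 N) ?add0n; last by move=> k _; rewrite lee_fin.
rewrite [X in (_ + X)%E]eseries0 ?adde0; last first.
  by move=> k Nk _; rewrite /trunc_seq int_of_natK ltnNge Nk /= h0.
rewrite big_mkord sumEFin; congr (_%:E); apply: eq_bigr => k _.
by rewrite /trunc_seq int_of_natK ltn_ord.
Qed.

Fact ellZ_trunc_subproof N c :
  exists a : ellZ p1, forall n, a n = trunc_seq N c n.
Proof.
apply: ellZ_exists.
rewrite (integral_trunc_seq _ _ (h := fun x => `|x| `^ p)) ?ltry//.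
  by rewrite normr0 powR0 ?gt_eqF.
Qed.

Definition ellZ_trunc N c : ellZ p1 := projT1 (cid (ellZ_trunc_subproof N c)).

Lemma ellZ_truncE N c n : ellZ_trunc N c n = trunc_seq N c n.
Proof. exact: (projT2 (cid (ellZ_trunc_subproof N c))). Qed.

Lemma ellZ_trunc_norm N c :
  `|ellZ_trunc N c| `^ p = \sum_(k < N) `|c (int_of_nat k)| `^ p.
Proof.
apply: EFin_inj; rewrite ellZ_norm_powR.
rewrite -(@integral_trunc_seq N c (fun x => `|x| `^ p)).
- by apply: eq_integral => n _; rewrite ellZ_truncE.
- by rewrite normr0 powR0 ?gt_eqF.
- by move=> x; exact: powR_ge0.
Qed.

(** The unit vector at [m]; the cutoff is the smallest one that keeps coordinate [m]. *)
Definition ellZ_delta m : ellZ p1 :=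
  ellZ_trunc (nat_of_int m).+1 (fun n => (n == m)%:R).

Lemma ellZ_deltaE m n : ellZ_delta m n = (n == m)%:R.
Proof.
rewrite ellZ_truncE /trunc_seq; case: ifPn => //.
by case: eqP => // ->; rewrite ltnSn.
Qed.

Lemma ellZ_sumE (I : Type) (r : seq I) (P : pred I) (F : I -> ellZ p1) n :
  ellZ_fun (\sum_(i <- r | P i) F i) n = \sum_(i <- r | P i) F i n.
Proof.
by elim/big_rec2 : _ => // i y z _ <-.
Qed.

Lemma ellZ_delta_norm m : `|ellZ_delta m| = 1.
Proof.
have : `|ellZ_delta m| `^ p = 1.
  rewrite ellZ_trunc_norm (bigD1 ord_max)//= nat_of_intK eqxx normr1 powR1.
  rewrite big1 ?addr0// => k km.
  rewrite (_ : (_ == m) = false) ?normr0 ?powR0 ?(gt_eqF p0)//.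
  apply/eqP => kE; move/eqP : km; apply; apply/val_inj => /=.
  by rewrite -[LHS]int_of_natK kE.
move=> /(congr1 (fun x => x `^ p^-1)).
by rewrite -powRrM mulfV ?gt_eqF// powRr1// powR1.
Qed.

Lemma ellZ_trunc_sum N c : ellZ_trunc N c =
  \sum_(k < N) c (int_of_nat k) *: ellZ_delta (int_of_nat k).
Proof.
apply: ellZP => n; rewrite ellZ_truncE ellZ_sumE /trunc_seq.
under eq_bigr do rewrite ellZ_funZ ellZ_deltaE.
case: ifPn => nN.
  rewrite (bigD1 (Ordinal nN))//= nat_of_intK eqxx mulr1 big1 ?addr0// => k kn.
  rewrite (_ : _ == _ = false) ?mulr0//.
  apply/eqP => nE; move/eqP : kn; apply; apply/val_inj => /=.
  by rewrite nE int_of_natK.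
rewrite big1// => k _; rewrite (_ : _ == _ = false) ?mulr0//.
by apply/eqP => nE; move: nN; rewrite nE int_of_natK ltn_ord.
Qed.

Lemma ellZ_trunc_norm_le N c :
  `|ellZ_trunc N c| <= \sum_(k < N) `|c (int_of_nat k)|.
Proof.
rewrite ellZ_trunc_sum (le_trans (ler_norm_sum _ _ _))// ler_sum// => k _.
by rewrite normrZ ellZ_delta_norm mulr1.
Qed.

(** The p-th power of the error is the tail of a convergent series, so it falls below e^p. *)
Lemma ellZ_trunc_approx a (e : R) : 0 < e ->
  exists N, `|a - ellZ_trunc N a| < e.
Proof.
move=> e0.
have sumE : (\sum_(k <oo) (`|a (int_of_nat k)| `^ p)%:E = (`|a| `^ p)%:E)%E.
  rewrite ellZ_norm_powR integral_counting_int// => n; exact: powR_ge0.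
have tl : \forall N \near \oo,
    (\sum_(N <= k <oo) (`|a (int_of_nat k)| `^ p)%:E < (e `^ p)%:E)%E.
  apply: (@nneseries_tail_cvg _ (fun k => (`|a (int_of_nat k)| `^ p)%:E) xpredT
      _ _ [set y | (y < (e `^ p)%:E)%E]).
  - by rewrite sumE ltry.
  - by move=> k _; rewrite lee_fin powR_ge0.
  - apply: open_nbhs_nbhs; split; last by rewrite /= lte_fin powR_gt0.
    exact: open_ereal_lt_ereal.
have [N _ /(_ N (leqnn N)) tN] := tl.
(* Were the error at least [e], its p-th power, which is the tail from [N], would be at least
   e^p. *)
exists N; rewrite ltNge; apply/negP => /(ge0_ler_powR (ltW p0)) eN.
have {}eN := eN (ltW e0) (normr_ge0 _).
move: tN; rewrite ltNge => /negP; apply.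
rewrite (@le_trans _ _ (`|a - ellZ_trunc N a| `^ p)%:E)//.
rewrite ellZ_norm_powR integral_counting_int; last by move=> n; exact: powR_ge0.
rewrite (nneseries_split 0 N) ?add0n;
  last by move=> k _; rewrite lee_fin powR_ge0.
rewrite big_mkord big1 ?add0e; last first.
  move=> k _; rewrite ellZ_funB ellZ_truncE /trunc_seq int_of_natK.
  by rewrite ltn_ord subrr normr0 powR0 ?gt_eqF.
rewrite le_eqVlt; apply/orP; left; apply/eqP.
rewrite eseries_cond [RHS]eseries_cond; apply: eq_eseriesr => k Nk.
rewrite ellZ_funB ellZ_truncE /trunc_seq int_of_natK.
by rewrite ltnNge; move: Nk => /= ->; rewrite subr0.
Qed.

(** By the triangle inequality the truncations have l_p norm at most [S], and each coordinate is
    eventually constant, so Fatou puts the limit in l_p. This is what places x_t in l_p and f_t in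
    l_q. *)
Lemma ellZ_of_ell1 c (S : R) :
  (\esum_(n in [set: int]) `|c n|%:E <= S%:E)%E ->
  exists a : ellZ p1, forall n, a n = c n.
Proof.
move=> cS.
have [| |a [aE _]] := @ellZ_fatou _ _ p1 (fun k => ellZ_trunc k c) c S.
- move=> n; apply: cvg_near_cst; exists (nat_of_int n).+1 => // k /= nk.
  by rewrite ellZ_truncE /trunc_seq nk.
- move=> k; rewrite (le_trans (ellZ_trunc_norm_le _ _))// -lee_fin.
  rewrite (le_trans _ cS)// -integral_counting_esum//.
  rewrite integral_counting_int// -sumEFin.
  rewrite -(big_mkord xpredT (fun k => `|c (int_of_nat k)|%:E)).
  exact: nneseries_lim_ge.
by exists a.
Qed.

(** The difference of the two functionals vanishes on every truncation, and truncations are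
    dense. *)
Lemma topdual_delta_ext (g h : topdual (ellZ p1)) :
  (forall m, g (ellZ_delta m) = h (ellZ_delta m)) -> forall a, g a = h a.
Proof.
move=> gh a; pose f : topdual (ellZ p1) := g - h.
have fE b : f b = g b - h b by [].
have f0 N : f (ellZ_trunc N a) = 0.
  rewrite ellZ_trunc_sum linear_sum big1// => k _.
  rewrite linearZ; apply/eqP; rewrite scaler_eq0; apply/orP; right; apply/eqP.
  by rewrite [LHS]fE gh subrr.
apply/eqP; rewrite -subr_eq0 -fE -normr_le0; apply/ler_addgt0Pr => e e0.
rewrite add0r.
(* Adding 1 keeps the denominator positive when the functional has norm 0. *)
have d0 : 0 < e / (topdual_norm f + 1).
  by rewrite divr_gt0// ltr_wpDl// topdual_norm_ge0.
have [N aN] := ellZ_trunc_approx a d0.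
have -> : f a = f (a - ellZ_trunc N a) by rewrite linearB [X in _ - X]f0 subr0.
rewrite (le_trans (topdual_le_norm _ _))//.
rewrite (@le_trans _ _ ((topdual_norm f + 1) * `|a - ellZ_trunc N a|))//.
  by rewrite ler_wpM2r// lerDl.
by rewrite mulrC -ler_pdivlMr ?ltW// ltr_wpDl// topdual_norm_ge0.
Qed.

(** Finite sequences of rationals form a countable dense set: half of the allowed error goes to
    truncating, the other half to rounding the remaining coordinates. *)
Lemma ellZ_separable : separable_space (ellZ p1).
Proof.
pose rt (s : seq rat) (n : int) : R := ratr (nth 0 s (nat_of_int n)).
exists (range (fun s => ellZ_trunc (size s) (rt s))).
  by apply: sub_countable (card_image_le _ _) _; exact: countableP.
move=> O [a Oa] oO.
have /nbhs_ballP[e /= e0 aO] : nbhs a O by exact: open_nbhs_nbhs.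
have [N aN] := ellZ_trunc_approx a (divr_gt0 e0 (ltr0Sn R 1)).
(* The [N] rounding errors add up to at most e / 2; dividing by [N.+1] keeps [d] positive when [N]
   is 0. *)
pose d := e / 2 / N.+1%:R.
have d0 : 0 < d by rewrite !divr_gt0.
have rP (x : R) : exists r : rat, `|x - ratr r| <= d.
  have [r] : exists r, ratr r \in `]x, (x + d)[.
    by apply: rat_in_itvoo; rewrite ltrDl.
  rewrite in_itv/= => /andP[xr rx]; exists r.
  by rewrite distrC ger0_norm ?subr_ge0 ?ltW// ltrBlDl.
pose r k := projT1 (cid (rP (a (int_of_nat k)))).
have rE k : `|a (int_of_nat k) - ratr (r k)| <= d.
  exact: projT2 (cid (rP (a (int_of_nat k)))).
exists (ellZ_trunc N (rt (mkseq r N))); split; last first.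
  by exists (mkseq r N) => //; rewrite size_mkseq.
apply: aO; rewrite -ball_normE/= (splitr e).
rewrite -(subrK (ellZ_trunc N a) a) -addrA (le_lt_trans (ler_normD _ _))//.
apply: ltr_leD => //.
have -> : ellZ_trunc N a - ellZ_trunc N (rt (mkseq r N)) =
    ellZ_trunc N (fun n => a n - rt (mkseq r N) n).
  apply: ellZP => n; rewrite ellZ_funB !ellZ_truncE /trunc_seq.
  by case: ifP => //; rewrite subr0.
rewrite (le_trans (ellZ_trunc_norm_le _ _))//.
rewrite (@le_trans _ _ (\sum_(k < N) d))//.
  by apply: ler_sum => k _; rewrite /rt int_of_natK nth_mkseq.
rewrite sumr_const card_ord -[leLHS]mulr_natr /d -mulrA ler_piMr//.
  by rewrite ltW// divr_gt0.
by rewrite mulrC ler_pdivrMr// mul1r ler_nat.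
Qed.

End ellZ_truncation.

(** * Riesz duality between l_p and l_q *)

Section pairing_delta.
Context {R : realType} (p q : R) (p1 : 1 <= p) (q1 : 1 <= q).
Implicit Types (a : ellZ p1) (b : ellZ q1).

Lemma ellZ_pairingC a b : ellZ_pairing b a = ellZ_pairing a b.
Proof. by apply: eq_Rintegral => n _; rewrite mulrC. Qed.

Lemma ellZ_pairing_delta b m : ellZ_pairing b (ellZ_delta p1 m) = b m.
Proof.
transitivity (\int[@counting int R]_(n in [set m]) b m).
  rewrite Rintegral_mkcond; apply: eq_Rintegral => n _.
  rewrite ellZ_deltaE patchE; case: eqVneq => [->|nm]; last first.
    by rewrite mul0r ifF// in_set1 (negbTE nm).
  by rewrite mul1r ifT// in_set1.
rewrite Rintegral_cst//= /counting asboolT// fset_set1 cardfs1 /= mulr1.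
by [].
Qed.

End pairing_delta.

Lemma ellZ_pairing_delta_l (R : realType) (p q : R) (p1 : 1 <= p) (q1 : 1 <= q)
  (a : ellZ p1) m : ellZ_pairing (ellZ_delta q1 m) a = a m.
Proof. by rewrite ellZ_pairingC ellZ_pairing_delta. Qed.

Section riesz.
Context {R : realType} (p q : R) (p1 : 1 <= p) (q1 : 1 <= q).
Hypothesis pq : p^-1 + q^-1 = 1.

Let p0 : 0 < p. Proof. by rewrite (lt_le_trans ltr01). Qed.
Let q0 : 0 < q. Proof. by rewrite (lt_le_trans ltr01). Qed.

Let qM : (q - 1) * p = q.
Proof.
have : (p^-1 + q^-1) * (p * q) = p * q by rewrite pq mul1r.
rewrite mulrDl mulrA mulVf ?gt_eqF// mul1r mulrCA mulVf ?gt_eqF// mulr1 => h.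
by rewrite mulrBl mul1r mulrC -h addrK.
Qed.

Let powR_pred (x : R) : 0 < x -> x `^ q = x `^ (q - 1) * x.
Proof.
move=> x0; have {3}-> : x = x `^ 1 by rewrite powRr1// ltW.
by rewrite -powRD ?subrK// (gt_eqF x0) implybT.
Qed.

(** Testing [g] on a vector [a] with |a| = |u|^(q-1) and g(a) = |u|^q, where [u] is the truncated
    sequence, gives |u|^q <= |g| |u|^(q-1). Cancelling the power of |u| requires [u] nonzero, whence
    the case split. *)
Lemma ellZ_riesz_trunc_le (g : topdual (ellZ p1)) N :
  `|ellZ_trunc q1 N (fun n => g (ellZ_delta p1 n))| <= topdual_norm g.
Proof.
pose b n := g (ellZ_delta p1 n).
rewrite -/b.
set u := ellZ_trunc q1 N b.
have [->|u0] := eqVneq `|u| 0; first exact: topdual_norm_ge0.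
have {}u0 : 0 < `|u| by rewrite lt_neqAle eq_sym u0 normr_ge0.
(* The vector for which Hoelder's inequality against [b] is an equality. *)
pose c n := Num.sg (b n) * `|b n| `^ (q - 1).
set a := ellZ_trunc p1 N c.
have cE n : `|c n| `^ p = `|b n| `^ q.
  rewrite /c; have [->|bn0] := eqVneq (b n) 0.
    by rewrite sgr0 mul0r normr0 !powR0 ?gt_eqF.
  rewrite normrM normr_sg bn0 mul1r ger0_norm ?powR_ge0//.
  by rewrite -powRrM qM.
have aE : `|a| `^ p = `|u| `^ q.
  by rewrite !ellZ_trunc_norm; apply: eq_bigr => k _; exact: cE.
have aE' : `|a| = `|u| `^ (q - 1).
  apply: (powR_injective p0); rewrite ?nnegrE ?powR_ge0//.
  by rewrite -powRrM qM.
have gE : g a = `|u| `^ q.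
  rewrite {1}/a ellZ_trunc_sum linear_sum ellZ_trunc_norm.
  apply: eq_bigr => k _.
  rewrite linearZ -[LHS]/(c _ * b _) /c mulrAC.
  rewrite -normrEsg.
  have [->|bn0] := eqVneq (b (int_of_nat k)) 0.
    by rewrite normr0 mul0r powR0 ?gt_eqF.
  by rewrite mulrC powR_pred// normr_gt0.
have := topdual_le_norm g a.
rewrite gE aE' ger0_norm ?powR_ge0//.
rewrite powR_pred//.
by rewrite mulrC ler_pM2r// powR_gt0.
Qed.

(** The truncations of the sequence of values of [g] on unit vectors are uniformly bounded in l_q,
    so Fatou provides [b]. Its functional agrees with [g] on unit vectors, hence everywhere. *)
Lemma ellZ_riesz (g : topdual (ellZ p1)) :
  exists2 b : ellZ q1, `|b| <= topdual_norm g &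
    forall a, g a = ellZ_pairing b a.
Proof.
have [| |b [bE bg]] := @ellZ_fatou _ _ q1
  (fun N => ellZ_trunc q1 N (fun n => g (ellZ_delta p1 n)))
  (fun n => g (ellZ_delta p1 n)) (topdual_norm g).
- move=> n; apply: cvg_near_cst; exists (nat_of_int n).+1 => // k /= nk.
  by rewrite ellZ_truncE /trunc_seq nk.
- by move=> N; exact: ellZ_riesz_trunc_le.
exists b => // a.
rewrite -[RHS]/(ellZ_dual p1 pq b a); apply: topdual_delta_ext => m.
by rewrite -[LHS]bE; exact/esym/ellZ_pairing_delta.
Qed.

End riesz.

(** * Measurable sums, shifted sequences and the correlation bound *)

Lemma measurable_Rintegral_counting d (T : measurableType d) (R : realType)
    (F : int -> T -> R) : (forall n, measurable_fun [set: T] (F n)) ->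
  measurable_fun [set: T] (fun t => \int[@counting int R]_n F n t).
Proof.
move=> mF; apply: measurableT_comp; first exact: (fine_measurable).
(* The positive and negative parts are handled by the nonnegative case. *)
under eq_fun do rewrite integralE.
apply: emeasurable_funB.
- apply: (@measurable_integral_counting R _ _
    (fun n t => (fun m => (F m t)%:E)^\+ n)%E) => // n.
  have -> : ((fun t => (fun m => (F m t)%:E)^\+ n) =
      (fun t => (F n t)%:E)^\+)%E.
    by apply/funext => t; rewrite !funeposE.
  exact/measurable_funepos/measurable_EFinP.
- apply: (@measurable_integral_counting R _ _
    (fun n t => (fun m => (F m t)%:E)^\- n)%E) => // n.
  have -> : ((fun t => (fun m => (F m t)%:E)^\- n) =
      (fun t => (F n t)%:E)^\-)%E.
    by apply/funext => t; rewrite !funenegE.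
  exact/measurable_funeneg/measurable_EFinP.
Qed.

Lemma le_pairing (R : realType) (p q : R) (p1 : 1 <= p) (q1 : 1 <= q)
    (pq : p^-1 + q^-1 = 1) (a : ellZ p1) (b : ellZ q1) :
  (`|ellZ_pairing b a|%:E <= \int[@counting int R]_n (`|a n| * `|b n|)%:E)%E.
Proof.
rewrite /ellZ_pairing /Rintegral -abse_EFin fineK; last first.
  exact: integrable_fin_num (ellZ_pairing_integrable pq b a).
under [leRHS]eq_integral do rewrite -normrM.
exact: le_abse_integral.
Qed.

(** Prepares Hoelder's inequality for a_n and b_(n+k): the shifted sequence costs nothing in
    norm. *)
Lemma ellZ_shift (R : realType) (p : R) (p1 : 1 <= p) (a : ellZ p1) (k : int) :
  exists2 b : ellZ p1, `|b| = `|a| & forall n, b n = a (k + n).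
Proof.
have p0 : 0 < p by rewrite (lt_le_trans ltr01).
have sE : (\int[@counting int R]_n (`|a (k + n)| `^ p)%:E = (`|a| `^ p)%:E)%E.
  rewrite ellZ_norm_powR.
  rewrite [RHS](@integral_counting_shift R (fun n => (`|a n| `^ p)%:E) k)//.
have [|b bE] := @ellZ_exists _ _ p1 (fun n => a (k + n)).
  by rewrite sE ltry.
exists b => //; apply: (powR_injective p0); rewrite ?nnegrE//.
apply: EFin_inj; rewrite -sE ellZ_norm_powR.
by apply: eq_integral => n _; rewrite bE.
Qed.

Section correlation_bound.
Local Open Scope ereal_scope.
Context {R : realType} (p q : R) (p1 : (1 <= p)%R) (q1 : (1 <= q)%R).
Hypothesis pq : (p^-1 + q^-1 = 1)%R.
Variable f : measurableTypeR R -> R.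
Hypothesis mf : measurable_fun [set: measurableTypeR R] f.
Variable S : R.
Hypothesis fS : translation_sup f <= S%:E.
Local Notation mu := (@lebesgue_measure R).

Let F (n : int) (t : measurableTypeR R) : \bar R := `|f (t - n%:~R)%R|%:E.

Lemma measurable_translated (n : int) :
  measurable_fun [set: measurableTypeR R]
    (fun t : measurableTypeR R => f (t - n%:~R)%R).
Proof. by apply: measurableT_comp => //; exact: measurable_translate. Qed.

Let F0 n t : 0 <= F n t. Proof. by rewrite lee_fin. Qed.

Let mF n : measurable_fun [set: measurableTypeR R] (F n).
Proof.
by apply/measurable_EFinP/measurableT_comp => //; exact: measurable_translated.
Qed.

Let FS t : \int[counting]_n F n t <= S%:E.
Proof.
rewrite integral_counting_esum//; apply: le_trans fS.
by apply: ereal_sup_ubound; exists t.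
Qed.

(** The autocorrelation of |f| at lag [k]. *)
Let corr k := \int[mu]_t (F 0 t * F k t).

(** The integrand is the translate by [n] of the one defining [corr k], so only the difference of
    the two indices matters. *)
Let corr_shift n k : \int[mu]_t (F n t * F (n + k)%R t) = corr k.
Proof.
rewrite /corr -[RHS](@integral_translate _ n%:~R (fun t => F 0 t * F k t)).
- apply: eq_integral => t _; rewrite /F mulr0z subr0.
  by rewrite rmorphD/= opprD addrA.
- exact: emeasurable_funM.
- by move=> t; rewrite mule_ge0.
Qed.

(** Summing over [k] under the integral leaves |f(t)| times the sum of |f(t - k)|, which is at most
    [S] at every [t]. *)
Let sum_corr : \int[counting]_k corr k <= \int[mu]_t `|(f t)%:E| * S%:E.
Proof.
rewrite -tonelli_counting; last 2 first.
- by move=> k t; rewrite mule_ge0.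
- by move=> k; exact: emeasurable_funM.
have S0 : 0 <= S%:E by rewrite (le_trans _ (FS 0%R))// integral_ge0.
rewrite -ge0_integralZr//; last exact/measurableT_comp/measurable_EFinP.
apply: ge0_le_integral => //.
- by move=> t _; apply: integral_ge0 => n _; rewrite mule_ge0.
- apply: (@measurable_integral_counting _ _ _ (fun k t => F 0 t * F k t)) => k.
    by move=> t; rewrite mule_ge0.
  exact: emeasurable_funM.
- by apply: emeasurable_funM => //; exact/measurableT_comp/measurable_EFinP.
- move=> t _; rewrite ge0_integralZl//.
  by rewrite {1}/F mulr0z subr0 lee_pmul// integral_ge0.
Qed.

Lemma correlation_bound (a : ellZ p1) (b : ellZ q1) :
  \int[mu]_t ((\int[counting]_n (`|a n|%:E * F n t)) *
              (\int[counting]_n (`|b n|%:E * F n t))) <=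
  (`|a| * `|b|)%:E * (\int[mu]_t `|(f t)%:E| * S%:E).
Proof.
(* The general term of the product of the two sums, with the second index written as n + k. *)
pose H n k t := `|a n|%:E * `|b (n + k)%R|%:E * (F n t * F (n + k)%R t).
have H0 n k t : 0 <= H n k t by rewrite !mule_ge0.
have mH n k : measurable_fun [set: measurableTypeR R] (H n k).
  by apply: emeasurable_funM => //; exact: emeasurable_funM.
have -> : \int[mu]_t ((\int[counting]_n (`|a n|%:E * F n t)) *
              (\int[counting]_n (`|b n|%:E * F n t))) =
    \int[mu]_t \int[counting]_n \int[counting]_k H n k t.
  apply: eq_integral => t _.
  rewrite -ge0_integralZr//; last 2 first.
  - by move=> n _; rewrite mule_ge0.
  - by apply: integral_ge0 => n _; rewrite mule_ge0.
  apply: eq_integral => n _.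
  rewrite (@integral_counting_shift _ (fun m => `|b m|%:E * F m t) n);
    last by move=> m; rewrite mule_ge0.
  rewrite -ge0_integralZl//; last 2 first.
  - by move=> k _; rewrite mule_ge0.
  - by rewrite mule_ge0.
  by apply: eq_integral => k _; rewrite /H muleACA.
rewrite tonelli_counting; last 2 first.
- by move=> n t; exact: integral_ge0.
- by move=> n; exact: measurable_integral_counting.
under eq_integral do rewrite tonelli_counting//.
(* Here the outer measure is itself counting measure: the sums over [n] and [k] change places. *)
rewrite tonelli_counting//; last by move=> *; exact: integral_ge0.
apply: (@le_trans _ _ (\int[counting]_k ((`|a| * `|b|)%:E * corr k)));
  last first.
  rewrite ge0_integralZl//; last first.
    by move=> k _; apply: integral_ge0 => t _; rewrite mule_ge0.
  by apply: lee_wpmul2l sum_corr; rewrite lee_fin mulr_ge0.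
have corr0 k : 0 <= corr k by apply: integral_ge0 => t _; rewrite mule_ge0.
apply: ge0_le_integral => //.
- by move=> k _; apply: integral_ge0 => n _; exact: integral_ge0.
move=> k _.
have HE n : \int[mu]_t H n k t = `|a n|%:E * `|b (n + k)%R|%:E * corr k.
  rewrite ge0_integralZl ?corr_shift//; first exact: emeasurable_funM.
    by move=> t _; rewrite mule_ge0.
under eq_integral do rewrite HE.
rewrite ge0_integralZr//.
rewrite lee_wpmul2r//.
(* For fixed [k], Hoelder applied to [a] and the shift of [b] bounds the sum over [n] by |a| |b|,
   uniformly in [k]. *)
have [b' b'b b'E] := ellZ_shift b k.
rewrite -b'b mulrC (le_trans _ (ellZ_pairing_abs pq b' a))//.
apply: ge0_le_integral => // n _.
by rewrite abse_EFin b'E normrM EFinM (addrC k).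
Qed.

End correlation_bound.

(** * Borel measurability of maps into a product of separable spaces *)

Lemma borel_measurable_comp d (M : measurableType d) (T U : topologicalType)
    (F : M -> T) (h : T -> U) :
  continuous h -> borel_measurable F -> borel_measurable (h \o F).
Proof.
by move=> /continuousP hc mF V oV; rewrite comp_preimage; exact/mF/hc.
Qed.

(** By separability an open set of the product is a countable union of products of balls with
    centres in the dense sets and radii 1 / (k + 1), so measurable distances suffice. *)
Lemma borel_measurable_pair d (M : measurableType d) (R : realType)
    (X Y : normedModType R) (x : M -> X) (y : M -> Y) :
  separable_space X -> separable_space Y ->
  (forall a r, measurable [set t | `|a - x t| < r]) ->
  (forall b r, measurable [set t | `|b - y t| < r]) ->
  borel_measurable (fun t => (x t, y t)).
Proof.
move=> [A cA dA] [B cB dB] mx my U oU.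
pose D := [set i : (X * Y) * nat | (A i.1.1 /\ B i.1.2) /\
  forall u v, `|i.1.1 - u| < i.2.+1%:R^-1 -> `|i.1.2 - v| < i.2.+1%:R^-1 ->
    U (u, v)].
have cD : countable D.
  apply: (@sub_countable _ _ _ ((A `*` B) `*` [set: nat])).
    by apply: subset_card_le => -[[a b] k] [[Aa Bb] _].
  by apply: countableX => //; exact: countableX.
have -> : (fun t => (x t, y t)) @^-1` U = \bigcup_(i in D)
   ([set t | `|i.1.1 - x t| < i.2.+1%:R^-1] `&`
    [set t | `|i.1.2 - y t| < i.2.+1%:R^-1]).
  apply/seteqP; split=> t /=; last first.
    by move=> [[[a b] k] [_ /= h] [/= xa yb]]; exact: h.
  move=> Ut.
  have [[P Q] /= [/nbhs_ballP[e1 /= e10 xP] /nbhs_ballP[e2 /= e20 yQ]] PQ] :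
    nbhs (x t, y t) U by exact: open_nbhs_nbhs.
  pose e := Num.min e1 e2.
  have e0 : 0 < e by rewrite lt_min e10.
  (* A radius below e / 2 allows two triangle sides: from the value at [t] to a nearby centre, and
     from that centre to any point of its ball. *)
  have [k ke] : exists k, k.+1%:R^-1 < e / 2 :> R.
    have e20' : 0 < e / 2 by rewrite divr_gt0.
    have [k _ /(_ k (leqnn k))] := near_infty_natSinv_lt (PosNum e20').
    by exists k.
  have k0 : 0 < k.+1%:R^-1 :> R by rewrite invr_gt0.
  have [a [xa Aa]] : ball (x t) k.+1%:R^-1 `&` A !=set0.
    apply: dA; last exact: ball_open.
    by exists (x t); exact: ballxx.
  have [b [yb Bb]] : ball (y t) k.+1%:R^-1 `&` B !=set0.
    apply: dB; last exact: ball_open.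
    by exists (y t); exact: ballxx.
  rewrite -ball_normE/= in xa; rewrite -ball_normE/= in yb.
  have tri (V : normedModType R) (u v w : V) : `|u - v| < k.+1%:R^-1 ->
      `|v - w| < k.+1%:R^-1 -> `|u - w| < e.
    move=> uv vw; rewrite -(subrK v u) -addrA (le_lt_trans (ler_normD _ _))//.
    by rewrite (splitr e) ltrD// (lt_trans _ ke).
  exists ((a, b), k); last by split; rewrite /= distrC.
  split=> // u v /= au bv; apply: PQ; split => /=.
    apply: xP; rewrite -ball_normE/=; apply: lt_le_trans (tri _ _ _ _ xa au) _.
    by rewrite ge_min lexx.
  apply: yQ; rewrite -ball_normE/=; apply: lt_le_trans (tri _ _ _ _ yb bv) _.
  by rewrite ge_min lexx orbT.
rewrite bigcup_set_type; apply: countable_bigcupT_measurable.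
  by rewrite (eq_countable (card_setT D)).
by move=> i; exact: measurableI.
Qed.

Section ellZ_dual_continuous.
Context {R : realType} (p q : R) (p1 : 1 <= p) (q1 : 1 <= q).
Hypothesis pq : p^-1 + q^-1 = 1.

Lemma ellZ_dual_linear : linear (ellZ_dual p1 pq : ellZ q1 -> _).
Proof.
have qp : q^-1 + p^-1 = 1 by rewrite addrC.
move=> r b c; apply/val_inj/funext => a.
rewrite -[LHS]/(ellZ_pairing _ a).
rewrite -[RHS]/(r * ellZ_pairing b a + ellZ_pairing c a).
rewrite !(ellZ_pairingC a); exact: (ellZ_pairing_linear qp).
Qed.

(** Hoelder makes the map from l_q to the dual of l_p norm-nonincreasing. Its continuity carries
    measurability from l_q to the dual with its norm topology. *)
Lemma ellZ_dual_continuous : continuous (ellZ_dual p1 pq : ellZ q1 -> _).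
Proof.
pose h : {linear ellZ q1 -> topdual (ellZ p1)} :=
  HB.pack (ellZ_dual p1 pq : ellZ q1 -> topdual (ellZ p1))
    (GRing.isLinear.Build _ _ _ _ _ ellZ_dual_linear).
apply: (@bounded_linear_continuous _ _ _ h); apply/linear_boundedP.
near=> r => b; apply: topdual_norm_le => [|a].
  by rewrite mulr_ge0.
rewrite (le_trans (ellZ_pairing_le pq _ _))// ler_wpM2r// -[leLHS]mul1r.
by rewrite ler_wpM2r.
Unshelve. all: by end_near. Qed.

End ellZ_dual_continuous.

(** The p-th power of the distance is a sum of nonnegative measurable functions of the
    coordinates. *)
Lemma measurable_ellZ_dist d (M : measurableType d) (R : realType) (p : R)
    (p1 : 1 <= p) (x : M -> ellZ p1) :
  (forall n, measurable_fun [set: M] (fun t => x t n)) ->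
  forall a r, measurable [set t | `|a - x t| < r].
Proof.
move=> mx a r.
have p0 : 0 < p by rewrite (lt_le_trans ltr01).
(* Comparing p-th powers requires a positive radius; otherwise the set is empty. *)
have [r0|r0] := leP r 0.
  rewrite (_ : [set _ | _] = set0)//; apply/seteqP; split=> // t /=.
  by move=> /lt_le_trans/(_ r0); rewrite normr_lt0.
pose G t := (\int[@counting int R]_n (`|a n - x t n| `^ p)%:E)%E.
have mG : measurable_fun [set: M] G.
  apply: (@measurable_integral_counting _ _ _
    (fun n t => (`|a n - x t n| `^ p)%:E)) => n.
    by move=> t; rewrite lee_fin powR_ge0.
  apply/measurable_EFinP/(measurableT_comp (measurable_powR _)).
  apply: measurableT_comp => //.
  by apply: measurable_funB => //; exact: mx.
have GE t : G t = (`|a - x t| `^ p)%:E by rewrite ellZ_norm_powR.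
have -> : [set t | `|a - x t| < r] =
    [set: M] `&` [set t | (G t < (r `^ p)%:E)%E].
  rewrite setTI; apply/seteqP; split=> t /=; rewrite GE lte_fin.
    by apply: gt0_ltr_powR; rewrite ?nnegrE// ltW.
  move=> h; rewrite ltNge; apply/negP => /(ge0_ler_powR (ltW p0)).
  by rewrite leNgt h => /(_ (ltW r0) (normr_ge0 _)).
by apply: emeasurable_fun_infty_o.
Qed.

(** * Bounded functionals and the least suppression constant *)

Lemma bounded_functional (R : realType) (X : normedModType R) (h : X -> R^o)
    (C : R) : linear h -> (forall x, `|h x| <= C * `|x|) ->
  exists g : topdual X, forall x, g x = h x.
Proof.
move=> lh hC.
pose h' : {linear X -> R^o} := HB.pack h (GRing.isLinear.Build _ _ _ _ _ lh).
have ch : continuous h.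
  apply: (@bounded_linear_continuous _ _ _ h'); apply/linear_boundedP.
  near=> r => x; rewrite (le_trans (hC x))// ler_wpM2r//.
by exists (TopDual (asboolT (conj lh ch))).
Unshelve. all: by end_near. Qed.

(** The bounds are closed under infimum. The pair with g(x) nonzero has |x| |g| > 0, which forces
    every bound to be nonnegative, so the infimum exists. *)
Lemma least_suppression_constant d (M : measurableType d) (R : realType)
    (mu : {sigma_finite_measure set M -> \bar R}) (X : completeNormedModType R)
    (psi : M -> X * topdual X) (C : R) (x : X) (g : topdual X) :
  g x != 0 -> suppression_bound mu psi C ->
  exists2 B, is_suppression_constant mu psi B & B <= C.
Proof.
move=> gx0 psiC.
have gx : 0 < `|x| * `|g|.
  rewrite mulrC (lt_le_trans _ (topdual_le_norm g x))// normr_gt0//.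
pose BB := [set B | suppression_bound mu psi B].
have BB0 : has_inf BB.
  split; first by exists C.
  exists 0 => B /(_ _ measurableT x g) /(le_trans (normr_ge0 _)).
  by rewrite -mulrA pmulr_lge0.
exists (inf BB); last by apply: ge_inf => //; case: BB0.
split; last by move=> B' psiB'; apply: ge_inf => //; case: BB0.
move=> E mE u h.
have [uh|uh] := eqVneq (`|u| * `|h|) 0.
  by have := psiC E mE u h; rewrite -!mulrA uh !mulr0.
have {}uh : 0 < `|u| * `|h| by rewrite lt_neqAle eq_sym uh mulr_ge0.
rewrite -mulrA -ler_pdivrMr//; apply: lb_le_inf; first by exists C.
by move=> B /(_ E mE u h); rewrite ler_pdivrMr// mulrA.
Qed.

Lemma translation_sup_ge0 (R : realType) (f : R -> R) :
  (0 <= translation_sup f)%E.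
Proof.
apply: (@le_trans _ _ (\esum_(n in [set: int]) `|f (0 - n%:~R)|%:E)%E).
  exact: esum_ge0.
by apply: ereal_sup_ubound; exists 0.
Qed.

(** * The frame of integer translates *)

Section translation_frame.
Context {R : realType} (p q : R) (p1 : 1 <= p) (q1 : 1 <= q).
Hypothesis pq : p^-1 + q^-1 = 1.
Variable f : measurableTypeR R -> R.
Hypothesis mf : measurable_fun [set: measurableTypeR R] f.
Variables (S C : R).
Hypothesis fS : (translation_sup f <= S%:E)%E.
Local Notation mu := (@lebesgue_measure R).
Hypothesis fC : (\int[mu]_t `|(f t)%:E| * S%:E = C%:E)%E.
Variables (x : measurableTypeR R -> ellZ p1) (y : measurableTypeR R -> ellZ q1).
Hypothesis xE : forall t n, x t n = f (t - n%:~R).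
Hypothesis yE : forall t n, y t n = f (t - n%:~R).

Let qp : q^-1 + p^-1 = 1. Proof. by rewrite addrC. Qed.

(** The frame integrand f_t(a) g(x_t) for the functional [g] represented by [b]. *)
Let L (a : ellZ p1) (b : ellZ q1) (t : measurableTypeR R) : R :=
  ellZ_pairing (y t) a * ellZ_pairing b (x t).

Let mL a b : measurable_fun [set: measurableTypeR R] (L a b).
Proof.
apply: measurable_funM.
  apply: (@measurable_Rintegral_counting _ _ _ (fun n t => a n * y t n)) => n.
  under eq_fun do rewrite yE.
  by apply: measurable_funM => //; exact: measurable_translated.
apply: (@measurable_Rintegral_counting _ _ _ (fun n t => x t n * b n)) => n.
under eq_fun do rewrite xE.
by apply: measurable_funM => //; exact: measurable_translated.
Qed.

Let L_le a b : (\int[mu]_t `|(L a b t)%:E| <= (C * `|a| * `|b|)%:E)%E.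
Proof.
have -> : ((C * `|a| * `|b|)%:E =
    (`|a| * `|b|)%:E * (\int[mu]_t `|(f t)%:E| * S%:E))%E.
  by rewrite fC -EFinM; congr (_%:E); rewrite -mulrA mulrC.
apply: le_trans (correlation_bound pq mf fS a b).
apply: ge0_le_integral => //.
- exact/measurableT_comp/measurable_EFinP.
- have mI (c : int -> R) : measurable_fun [set: measurableTypeR R]
    (fun t : measurableTypeR R => \int[@counting int R]_n
      (`|c n|%:E * `|f (t - n%:~R)%R|%:E))%E.
    apply: (@measurable_integral_counting _ _ _
      (fun n (t : measurableTypeR R) =>
        `|c n|%:E * `|f (t - n%:~R)%R|%:E)%E) => n.
      by move=> t; rewrite mule_ge0.
    apply: emeasurable_funM => //.
    apply/measurable_EFinP/measurableT_comp => //.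
    exact: measurable_translated.
  by apply: emeasurable_funM.
move=> t _; rewrite abse_EFin normrM EFinM; apply: lee_pmul => //.
  apply: le_trans (le_pairing pq _ _) _; rewrite le_eqVlt; apply/orP; left.
  by apply/eqP/eq_integral => n _; rewrite EFinM yE.
apply: le_trans (le_pairing pq _ _) _; rewrite le_eqVlt; apply/orP; left.
by apply/eqP/eq_integral => n _; rewrite EFinM xE muleC.
Qed.

Let L_integrable a b : mu.-integrable setT (EFin \o L a b).
Proof.
apply/integrableP; split; first exact/measurable_EFinP.
by rewrite (le_lt_trans (L_le a b))// ltry.
Qed.

Let L_integrableS E a b : measurable E -> mu.-integrable E (EFin \o L a b).
Proof. by move=> mE; exact: integrableS (L_integrable a b). Qed.

Let L_Rintegral_le E a b : measurable E ->
  `|\int[mu]_(t in E) L a b t| <= C * `|a| * `|b|.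
Proof.
move=> mE; rewrite -lee_fin (le_trans _ (L_le a b))//.
rewrite /Rintegral -abse_EFin fineK;
  last exact: integrable_fin_num (L_integrableS a b mE).
apply: le_trans (le_abse_integral _ mE _) _.
  by apply/measurable_EFinP; exact: measurable_funS (mL a b).
apply: ge0_subset_integral => //.
exact/measurableT_comp/measurable_EFinP.
Qed.

Let L_linear_r E a : measurable E ->
  linear (fun b => \int[mu]_(t in E) L a b t : R^o).
Proof.
move=> mE r b c.
rewrite -[RHS]/(r * (\int[mu]_(t in E) L a b t) + \int[mu]_(t in E) L a c t).
rewrite -RintegralZl//; last exact: L_integrableS.
rewrite -RintegralD//; last 2 first.
- exact: integrableZl (L_integrableS a b mE).
- exact: L_integrableS.
apply: eq_Rintegral => t _; rewrite /L !(ellZ_pairingC (x t)).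
rewrite (ellZ_pairing_linear qp (x t) r b c).
by rewrite mulrDr mulrCA.
Qed.

Let L_linear_l E b : measurable E ->
  linear (fun a => \int[mu]_(t in E) L a b t : R^o).
Proof.
move=> mE r a c.
rewrite -[RHS]/(r * (\int[mu]_(t in E) L a b t) + \int[mu]_(t in E) L c b t).
rewrite -RintegralZl//; last exact: L_integrableS.
rewrite -RintegralD//; last 2 first.
- exact: integrableZl (L_integrableS a b mE).
- exact: L_integrableS.
apply: eq_Rintegral => t _; rewrite /L.
rewrite (ellZ_pairing_linear pq (y t) r a c).
by rewrite mulrDl mulrA.
Qed.

Let psi t := (x t, ellZ_dual p1 pq (y t)).

Let psiE (g : topdual (ellZ p1)) a b t : (forall u, g u = ellZ_pairing b u) ->
  g ((psi t).2 a *: (psi t).1) = L a b t.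
Proof. by move=> gb; rewrite linearZ -[LHS]/(_ * g _) gb. Qed.

Lemma frame_suppression_bound : suppression_bound mu psi C.
Proof.
move=> E mE a g; have [b bg gb] := ellZ_riesz q1 pq g.
rewrite (_ : \int[mu]_(t in E) _ = \int[mu]_(t in E) L a b t); last first.
  by apply: eq_Rintegral => t _; rewrite gb.
have S0 : (0 <= S%:E)%E by rewrite (le_trans (translation_sup_ge0 f)).
(* The estimate comes with |b|; nonnegativity of [C] allows passing to the norm of [g], which
   dominates it. *)
have C0 : 0 <= C by rewrite -lee_fin -fC mule_ge0// integral_ge0.
by rewrite (le_trans (L_Rintegral_le _ _ mE))// ler_wpM2l// mulr_ge0.
Qed.

(** Riesz duality serves twice: with the exponents exchanged it produces [c] in l_p from a
    functional on l_q, and then it reduces every [g] to some [b]. The second conclusion is kept to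
    read off the coordinates of [c]. *)
Lemma frame_pettis E a : measurable E -> exists2 c : ellZ p1,
  is_pettis_integral mu E (fun t => (psi t).2 a *: (psi t).1) c &
  forall b, ellZ_pairing b c = \int[mu]_(t in E) L a b t.
Proof.
move=> mE.
have [h hE] := @bounded_functional _ _ _ (C * `|a|) (L_linear_r a mE)
  (fun b => L_Rintegral_le a b mE).
have [c _ hc] := ellZ_riesz p1 qp h.
have cE b : ellZ_pairing b c = \int[mu]_(t in E) L a b t.
  by rewrite -hE hc ellZ_pairingC.
exists c => // g; have [b _ gb] := ellZ_riesz q1 pq g; split.
  rewrite (_ : (fun t => _) = EFin \o L a b); first exact: L_integrableS.
  by apply/funext => t /=; rewrite -(psiE _ _ gb).
by rewrite gb cE; apply: eq_Rintegral => t _; rewrite -(psiE _ _ gb).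
Qed.

Hypothesis ortho : forall m n : int,
  \int[mu]_t (f (t - m%:~R) * f (t - n%:~R)) = (m == n)%:R.

(** Both sides are bounded functionals of [a], so it suffices to compare them on unit vectors, where
    the integral is an inner product of two translates of [f]. *)
Let L_delta a n : \int[mu]_t L a (ellZ_delta q1 n) t = a n.
Proof.
have hle c : `|\int[mu]_t L c (ellZ_delta q1 n) t| <=
    C * `|ellZ_delta q1 n| * `|c|.
  by rewrite mulrAC; exact: L_Rintegral_le.
have [h hE] :=
  bounded_functional (L_linear_l (ellZ_delta q1 n) measurableT) hle.
rewrite -hE -[RHS](ellZ_pairing_delta_l q1).
rewrite -[RHS]/(ellZ_dual p1 pq (ellZ_delta q1 n) a).
apply: topdual_delta_ext => m.
rewrite -[RHS]/(ellZ_pairing (ellZ_delta q1 n) (ellZ_delta p1 m)) hE.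
rewrite ellZ_pairing_delta_l ellZ_deltaE eq_sym -ortho.
apply: eq_Rintegral => t _.
by rewrite /L ellZ_pairing_delta ellZ_pairing_delta_l xE yE.
Qed.

Lemma frame_schauder : continuous_schauder_frame mu psi.
Proof.
split.
- exact: ellZ_separable.
(* Measurability is first proved in l_p x l_q, where both factors are separable, then transported
   along the continuous map to the dual. *)
- have mxy : borel_measurable (fun t => (x t, y t)).
    apply: borel_measurable_pair; [exact: ellZ_separable..| |].
      apply: measurable_ellZ_dist => n; under eq_fun do rewrite xE.
      exact: measurable_translated.
    apply: measurable_ellZ_dist => n; under eq_fun do rewrite yE.
    exact: measurable_translated.
  apply: (borel_measurable_comp (h := fun u => (u.1, ellZ_dual p1 pq u.2))) mxy.
  move=> [u v] W [[P Q] /= [Pu Qv] PQW].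
  exists (P, ellZ_dual p1 pq @^-1` Q) => /=.
    by split=> //; exact: ellZ_dual_continuous.
  by move=> [u' v'] [/= Pu' Qv']; exact: PQW.
move=> a; split.
  by move=> E mE; have [c cP _] := frame_pettis a mE; exists c.
have [c cP cE] := frame_pettis a measurableT.
suff ca : c = a by rewrite ca in cP.
(* Testing the Pettis integral against the unit vector at [n] gives its [n]-th coordinate. *)
apply: ellZP => n; rewrite -[RHS]L_delta -cE.
exact/esym/ellZ_pairing_delta_l.
Qed.

End translation_frame.



Theorem theorem5p2 (R : realType) (p q : R) (hp : 1 < p)
    (hq : q = p / (p - 1)) (f : measurableTypeR R -> R)
    (hf : measurable_fun [set: measurableTypeR R] f)
    (hL1 : f \in Lfun (@lebesgue_measure R) 1)
    (hON : orthonormal_L2 (@lebesgue_measure R)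
             (fun (n : int) (t : measurableTypeR R) => f (t - n%:~R)))
    (hsup : (translation_sup f < +oo)%E) :
  exists (x : measurableTypeR R -> ellZ (ltW hp))
         (y : measurableTypeR R -> ellZ (conjugate_ge1 hp hq)),
    let psi t := (x t, ellZ_dual (ltW hp) (conjugate_sum hp hq) (y t)) in
    [/\ forall t n, x t n = f (t - n%:~R),
        forall t n, y t n = f (t - n%:~R),
        continuous_schauder_frame (@lebesgue_measure R) psi &
        exists2 Bs : R, is_suppression_constant (@lebesgue_measure R) psi Bs &
          (Bs%:E <= 'N[@lebesgue_measure R]_1[EFin \o f] * translation_sup f)%E].
Proof.
have ts0 := translation_sup_ge0 f.
pose S := fine (translation_sup f).
have SE : translation_sup f = S%:E by rewrite fineK// ge0_fin_numE.
have /Lfun1_integrable/integrableP[_ fint] := hL1.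
have i0 : (0 <= \int[@lebesgue_measure R]_t `|(f t)%:E|)%E.
  exact: integral_ge0.
pose C := fine (\int[@lebesgue_measure R]_t `|(f t)%:E|)%E * S.
have CE : (\int[@lebesgue_measure R]_t `|(f t)%:E| * S%:E = C%:E)%E.
  by rewrite /C -SE EFinM -SE fineK// ge0_fin_numE.
have fS : (translation_sup f <= S%:E)%E by rewrite SE.
(* The supremum runs over all [t], so x_t and f_t are defined at every point and not merely almost
   everywhere. *)
have esumS (t : measurableTypeR R) :
    (\esum_(n in [set: int]) `|f (t - n%:~R)|%:E <= S%:E)%E.
  by apply: le_trans fS; apply: ereal_sup_ubound; exists t.
have /choice[x xE] (t : measurableTypeR R) :
    exists u : ellZ (ltW hp), forall n, u n = f (t - n%:~R).
  exact: ellZ_of_ell1 (esumS t).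
have /choice[y yE] (t : measurableTypeR R) :
    exists u : ellZ (conjugate_ge1 hp hq), forall n, u n = f (t - n%:~R).
  exact: ellZ_of_ell1 (esumS t).
exists x, y; split => //.
  by apply: (frame_schauder _ hf fS CE xE yE) => m n; case: hON.
(* The unit vector at 0 and its coordinate functional pair to 1, which supplies the nonzero
   value. *)
have [|B sB BC] := least_suppression_constant
  (x := ellZ_delta (ltW hp) 0)
  (g := ellZ_dual (ltW hp) (conjugate_sum hp hq)
    (ellZ_delta (conjugate_ge1 hp hq) 0)) _
  (frame_suppression_bound (conjugate_sum hp hq) hf fS CE xE yE).
  rewrite -[X in X != _]/(ellZ_pairing _ _) ellZ_pairing_delta_l ellZ_deltaE.
  rewrite eqxx.
  exact: oner_neq0.
by exists B => //; rewrite Lnorm1 SE CE lee_fin.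
Qed.
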